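(* Let $q$ be a prime power, let $m>7$, let $\alpha\in\mathbb{F}_{q^m}$ be primitive, i.e. $\mathbb{F}_{q^m}^*=\langle\alpha\rangle$, and let $\gamma\in\mathbb{F}_q$ be such that $\gamma\neq(\alpha^{[s]}+\alpha)(\alpha^{2[s]}+\alpha^{[s]+1}+\alpha^2)$ for any $0<s<m$ with $\gcd(s,m)=1$. Then \[G=\begin{pmatrix}1&0&\alpha&\alpha^2&\alpha^3\\0&1&\alpha^2&\alpha^4&\gamma\alpha\end{pmatrix}\] is a generator matrix of an MRD code $\mathcal{C}\subseteq\mathbb{F}_{q^m}^5$ of dimension $k=2$ that is not a generalized Gabidulin code.
   Context: Notation: $[i]:=q^i$ (so $\alpha^{2[s]}=\alpha^{2q^s}$ and $\alpha^{[s]+1}=\alpha^{q^s+1}$). The rank over $\mathbb{F}_q$ of $\boldsymbol{x}=(x_1,\dots,x_n)\in\mathbb{F}_{q^m}^n$ is $\dim_{\mathbb{F}_q}\langle x_1,\dots,x_n\rangle_{\mathbb{F}_q}$, and the minimum rank distance of a nonzero linear code is the minimum rank of its nonzero codewords. A nonzero $\mathbb{F}_{q^m}$-linear code in $\mathbb{F}_{q^m}^n$ of dimension $k$ (over $\mathbb{F}_{q^m}$) is an MRD code if its minimum rank distance equals $n-k+1$. A generalized Gabidulin code of dimension $k$ is a linear code in $\mathbb{F}_{q^m}^n$ having, for some $s\in\mathbb{N}$ with $\gcd(s,m)=1$ and some $g_1,\dots,g_n\in\mathbb{F}_{q^m}$ linearly independent over $\mathbb{F}_q$, a generator matrix whose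 $i$-th row is $(g_1^{[s(i-1)]},\dots,g_n^{[s(i-1)]})$ for $i=1,\dots,k$.
   Formalization: The hypothesis γ ≠ 0 is added: γ = 0 satisfies the printed condition for every primitive α with m > 7, but then the second row (0, 1, α², α⁴, 0) is a codeword of rank 3 < 4, so the code is not MRD. *)

(* Defs.v *)
From HB Require Import structures.
From mathcomp Require Import all_boot all_order all_algebra all_field.

Set Implicit Arguments.
Unset Strict Implicit.
Unset Printing Implicit Defensive.

Import GRing.Theory.
Local Open Scope ring_scope.

(* Throughout, F is the finite field F_q with q = #|F|, and L is the extension
   F_{q^m} with m = \dim {:L}. Codes of length n are L-subspaces of 'rV[L]_n,
   whereas ranks are dimensions over F. *)

(* L^* is the cyclic group generated by a. *)
Definition is_primitive_elt (F : finFieldType) (L : fieldExtType F) (a : L) :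
  Prop :=
  forall x : L, x != 0 <-> exists i : int, x = a ^ i.

Definition rank_weight (F : finFieldType) (L : fieldExtType F) (n : nat)
  (x : 'rV[L]_n) : nat :=
  \dim <<[tuple x ord0 i | i < n]>>%VS.

(* Relational because L carries no finType structure to minimise over. *)
Definition is_min_rank_distance (F : finFieldType) (L : fieldExtType F)
  (n : nat) (C : {vspace 'rV[L]_n}) (d : nat) : Prop :=
  (exists c : 'rV[L]_n, [/\ c \in C, c != 0 & rank_weight c = d]) /\
  (forall c : 'rV[L]_n, c \in C -> c != 0 -> (d <= rank_weight c)%N).

Definition is_MRD (F : finFieldType) (L : fieldExtType F) (n : nat)
  (C : {vspace 'rV[L]_n}) : Prop :=
  C != 0%VS /\ is_min_rank_distance C (n - \dim C + 1)%N.

Definition is_generator_matrix (L : fieldType) (k n : nat)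
  (G : 'M[L]_(k, n)) (C : {vspace 'rV[L]_n}) : Prop :=
  basis_of C [tuple row i G | i < k].

(* The row index i starts at 0, so it stands for i - 1 in the usual 1-based
   exponent q^(s(i-1)). *)
Definition gabidulin_mx (F : finFieldType) (L : fieldExtType F) (k n s : nat)
  (g : n.-tuple L) : 'M[L]_(k, n) :=
  \matrix_(i < k, j < n) tnth g j ^+ (#|F| ^ (s * i)).

Definition is_generalized_gabidulin (F : finFieldType) (L : fieldExtType F)
  (n k : nat) (C : {vspace 'rV[L]_n}) : Prop :=
  exists (s : nat) (g : n.-tuple L),
    [/\ coprime s (\dim {:L}), free g &
        is_generator_matrix (gabidulin_mx k s g) C].

Definition alpha_gamma_mx (F : finFieldType) (L : fieldExtType F)
  (alpha : L) (gamma : F) : 'M[L]_(2, 5) :=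
  \matrix_(i < 2, j < 5)
    nth 0 (nth [::]
      [:: [:: 1; 0; alpha     ; alpha ^+ 2; alpha ^+ 3     ];
          [:: 0; 1; alpha ^+ 2; alpha ^+ 4; gamma *: alpha ]] i) j.

(* Main.v *)
Require Import Defs.
From HB Require Import structures.
From mathcomp Require Import all_boot all_order all_algebra all_field.
From mathcomp Require Import ring.

Set Implicit Arguments.
Unset Strict Implicit.
Unset Printing Implicit Defensive.

Import GRing.Theory.
Local Open Scope ring_scope.

(* A nonzero codeword of rank at most 3 satisfies two independent F_q-linear
   relations v and w, so that det (G [v w]) = 0. This determinant is a
   polynomial of degree at most 7 < m in alpha whose coefficients are
   F_q-combinations of the 2x2 minors of [v w]; as alpha has degree m these
   coefficients vanish, and the Plucker relations (with gamma != 0) then force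
   all the minors to vanish.
   If the code were generated by g and its Frobenius twist g^[s], the first two
   coordinates would give the coefficients of g^[s] on the rows of G as the
   twists of those of g; comparing the third and fifth coordinates then yields
   exactly the excluded value of gamma. *)

(** * Primitive elements: degree and Frobenius orbit *)

Section PrimitiveElement.
Variables (F : finFieldType) (L : fieldExtType F) (a : L).
Hypothesis a_prim : is_primitive_elt a.

Lemma Fadjoin_primitive_elt : <<1; a>>%VS = {:L}%VS.
Proof.
apply/eqP; rewrite eqEsubv subvf /=; apply/subvP => x _.
have [->|/a_prim[i ->]] := eqVneq x 0; first exact: mem0v.
have aK : a \in <<1; a>>%AS by exact: memv_adjoin.
by case: i => n; rewrite ?NegzE -?exprnN ?rpredV rpredX.
Qed.

Lemma adjoin_degree_primitive_elt : adjoin_degree 1 a = \dim {:L}.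
Proof. by rewrite -Fadjoin_primitive_elt dim_Fadjoin dimv1 muln1. Qed.

(** The powers of [a] exhaust the nonzero elements, so [a] generates L over F and its minimal
    polynomial has degree m, too large to divide a nonzero [p] of degree below m. *)
Lemma poly_primitive_elt_eq0 (p : {poly F}) : (size p <= \dim {:L})%N ->
  (map_poly (in_alg L) p).[a] = 0 -> p = 0.
Proof.
move=> sz_p pa0; apply/eqP; rewrite -(map_poly_eq0 (in_alg L)); apply/eqP.
apply: contraTeq sz_p => nz_p; rewrite -ltnNge.
have dv : minPoly 1 a %| map_poly (in_alg L) p.
  by apply: minPoly_dvdp; [exact: (alg_polyOver 1%AS)|apply/rootP].
have := dvdp_leq nz_p dv.
by rewrite size_minPoly adjoin_degree_primitive_elt size_map_poly.
Qed.

(** If [a] were fixed, so would be all its powers; then all q^m elements of L would be roots of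
    X^(q^s) - X, whose degree is only q^s. *)
Lemma primitive_elt_frob_neq (s : nat) :
  (0 < s)%N -> (s < \dim {:L})%N -> a ^+ (#|F| ^ s) != a.
Proof.
move=> s_gt0 s_lt; apply/eqP => aq.
have q_gt1 : (1 < #|F|)%N by exact: finNzRing_gt1.
have qs_gt1 : (1 < #|F| ^ s)%N by rewrite -(exp1n s) ltn_exp2r.
pose p : {poly finvect_type L} := 'X^(#|F| ^ s) - 'X.
have sz_p : size p = (#|F| ^ s).+1.
  by rewrite size_polyDl size_polyXn // size_polyN size_polyX ltnS.
have p_neq0 : p != 0 by rewrite -size_poly_eq0 sz_p.
have fixed (x : L) : x ^+ (#|F| ^ s) = x.
  have [->|/a_prim[i ->]] := eqVneq x 0.
    by rewrite expr0n -leqn0 leqNgt ltnW.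
  by case: i => n;
    rewrite ?NegzE -?exprnN ?exprVn -?exprnP -exprM mulnC exprM aq.
have roots_p : all (root p) (enum (finvect_type L)).
  by apply/allP => x _; rewrite rootE !hornerE fixed subrr.
have := max_poly_roots p_neq0 roots_p (enum_uniq _).
rewrite -cardE -(card_vspacef (Vector.class (finvect_type L))) card_vspace.
by rewrite sz_p ltnS leq_exp2l // leqNgt s_lt.
Qed.

End PrimitiveElement.

(** * Powers of the Frobenius map *)

Section Frobenius.
Variables (F : finFieldType) (L : fieldExtType F).

Lemma frobD s (x y : L) :
  (x + y) ^+ (#|F| ^ s) = x ^+ (#|F| ^ s) + y ^+ (#|F| ^ s).
Proof.
apply: exprDn_pchar; rewrite pnatX; apply/orP; left.
have [p p_pr pF] := finPcharP F.
have pL : p \in [pchar L] by rewrite pchar_lalg.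
(* The additive group of F is a p-group, so q is a power of the characteristic. *)
by rewrite (eq_pnat _ (pcharf_eq pL)) -cardsT; exact: pprimeChar_pgroup pF.
Qed.

Lemma frob_scalar s (c : F) : (c%:A : L) ^+ (#|F| ^ s) = c%:A.
Proof.
elim: s => [|s IHs]; first by rewrite expn0 expr1.
by rewrite expnSr exprM IHs -in_algE -rmorphXn expf_card.
Qed.

(** Brings the unrestricted exponent of a Gabidulin code into the range below m where [gamma] is
    constrained. *)
Lemma frob_modn s (x : L) :
  x ^+ (#|F| ^ s) = x ^+ (#|F| ^ (s %% \dim {:L})).
Proof.
have xqm : x ^+ (#|F| ^ \dim {:L}) = x.
  rewrite -(card_vspace {: finvect_type L}) card_vspacef.
  exact: (@expf_card (finvect_type L)).
rewrite {1}(divn_eq s (\dim {:L})) expnD exprM; congr (_ ^+ _).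
elim: (s %/ _)%N => [|n IHn]; first by rewrite mul0n expn0 expr1.
by rewrite mulSn expnD exprM xqm.
Qed.

End Frobenius.

(** * Rank weight through F-linear relations among coordinates *)

Section RankRelations.
Variables (F : finFieldType) (L : fieldExtType F) (n : nat) (c : 'rV[L]_n).

Definition relation_map (v : 'rV[F]_n) : L := \sum_i v ord0 i *: c ord0 i.

Fact relation_map_is_linear : linear relation_map.
Proof.
move=> k v w; rewrite /relation_map scaler_sumr -big_split /=.
by apply: eq_bigr => i _; rewrite !mxE scalerDl scalerA.
Qed.

HB.instance Definition _ :=
  GRing.isLinear.Build F 'rV[F]_n L _ relation_map relation_map_is_linear.

Definition relations : {vspace 'rV[F]_n} := lker (linfun relation_map).

Lemma mem_relations v : (v \in relations) = (relation_map v == 0).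
Proof. by rewrite memv_ker lfunE. Qed.

(** Rank-nullity for [relation_map], whose image lies in the span of the coordinates of [c]. *)
Lemma leq_dim_relations_rank : (n <= \dim relations + rank_weight c)%N.
Proof.
have := limg_ker_dim (linfun relation_map) fullv.
rewrite capfv dimvf /dim /= mul1n => {1}<-.
rewrite leq_add2l; apply: dimvS; apply/subvP => _ /memv_imgP[v _ ->].
rewrite lfunE /= /relation_map; apply: memv_suml => i _; apply: memvZ.
by rewrite -[c _ _](tnth_mktuple (c ord0)) memv_span ?mem_tnth.
Qed.

End RankRelations.

(** If [K] is nonzero, some v in it has a coordinate v_i != 0, and the minors make every w in [K]
    equal to (w_i / v_i) v. *)
Lemma dimv_le1_minors (F : fieldType) (n : nat) (K : {vspace 'rV[F]_n}) :
    {in K &, forall v w : 'rV[F]_n, forall i j,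
       v ord0 i * w ord0 j = v ord0 j * w ord0 i} ->
  (\dim K <= 1)%N.
Proof.
move=> minors; have [->|nzK] := eqVneq K 0%VS; first by rewrite dimv0.
have [i nzi] : exists i, vpick K ord0 i != 0.
  apply/existsP; rewrite -negb_forall; apply: contra nzK => /forallP v0.
  by rewrite -vpick0; apply/eqP/rowP => i; rewrite mxE; exact/eqP.
apply: leq_trans (_ : (\dim <[vpick K]> <= 1)%N); last first.
  by rewrite dim_vline leq_b1.
apply/dimvS/subvP => w wK; apply/vlineP; exists (w ord0 i / vpick K ord0 i).
apply/rowP => j; rewrite mxE mulrAC; apply/(canRL (mulfK nzi)).
by rewrite mulrC (minors _ _ (memv_pick K) wK) mulrC.
Qed.

Lemma mem_generator_matrix (L : fieldType) k n (G : 'M[L]_(k, n))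
    (C : {vspace 'rV[L]_n}) (c : 'rV[L]_n) :
  is_generator_matrix G C -> reflect (exists u : 'rV_k, c = u *m G) (c \in C).
Proof.
move=> GC; rewrite -(span_basis GC); apply: (iffP idP) => [cC|[u ->]].
  exists (\row_i coord [tuple row i G | i < k] i c).
  rewrite mulmx_sum_row {1}(coord_span cC); apply: eq_bigr => i _.
  by rewrite mxE -tnth_nth tnth_mktuple.
rewrite mulmx_sum_row; apply: memv_suml => i _; apply: memvZ.
by rewrite -(tnth_mktuple (fun i => row i G)) memv_span ?mem_tnth.
Qed.

(** * The determinant of G [v w] and its minors *)

(** Horner form, lowest degree first; the entry 0 is the coefficient of a^6, where v4 w4 cancels. *)
Lemma alpha_gamma_det (R S : comNzRingType) (f : {rmorphism R -> S}) (a : S)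
    (gamma v1 v2 v3 v4 v5 w1 w2 w3 w4 w5 : R) :
  (f v1 + f v3 * a + f v4 * a ^+ 2 + f v5 * a ^+ 3) *
    (f w2 + f w3 * a ^+ 2 + f w4 * a ^+ 4 + f gamma * f w5 * a) -
  (f w1 + f w3 * a + f w4 * a ^+ 2 + f w5 * a ^+ 3) *
    (f v2 + f v3 * a ^+ 2 + f v4 * a ^+ 4 + f gamma * f v5 * a) =
  foldr (fun c y => y * a + f c) 0
    [:: v1 * w2 - v2 * w1;
        gamma * (v1 * w5 - v5 * w1) - (v2 * w3 - v3 * w2);
        v1 * w3 - v3 * w1 - (v2 * w4 - v4 * w2) + gamma * (v3 * w5 - v5 * w3);
        gamma * (v4 * w5 - v5 * w4) - (v2 * w5 - v5 * w2);
        v1 * w4 - v4 * w1 - (v3 * w4 - v4 * w3);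
        v3 * w4 - v4 * w3 - (v3 * w5 - v5 * w3);
        0; v5 * w4 - v4 * w5].
Proof. by rewrite /=; ring. Qed.

(** Write Mij for vi wj - vj wi. The linear equations leave M12 = M25 = M45 = 0, M14 = M34 = M35 =
    t, M23 = gamma M15 and M13 = M24 - gamma t. If t = 0, the Plucker relations give gamma M15^2 = 0
    and M24^2 = 0. Otherwise they give M24 = 0, M15 = t and gamma t^2 = 0, a contradiction. *)
Lemma minors_alpha_gamma_eq0 (F : fieldType) (gamma : F)
    (v1 v2 v3 v4 v5 w1 w2 w3 w4 w5 : F) :
  gamma != 0 ->
  v1 * w2 - v2 * w1 = 0 ->
  gamma * (v1 * w5 - v5 * w1) - (v2 * w3 - v3 * w2) = 0 ->
  v1 * w3 - v3 * w1 - (v2 * w4 - v4 * w2) + gamma * (v3 * w5 - v5 * w3) = 0 ->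
  gamma * (v4 * w5 - v5 * w4) - (v2 * w5 - v5 * w2) = 0 ->
  v1 * w4 - v4 * w1 - (v3 * w4 - v4 * w3) = 0 ->
  v3 * w4 - v4 * w3 - (v3 * w5 - v5 * w3) = 0 ->
  v5 * w4 - v4 * w5 = 0 ->
  [/\ v1 * w3 - v3 * w1 = 0, v1 * w4 - v4 * w1 = 0, v1 * w5 - v5 * w1 = 0,
      v2 * w3 - v3 * w2 = 0
    & [/\ v2 * w4 - v4 * w2 = 0, v2 * w5 - v5 * w2 = 0,
          v3 * w4 - v4 * w3 = 0 & v3 * w5 - v5 * w3 = 0]].
Proof.
move=> nz_g.
pose M a b c d : F := a * d - b * c.
have plucker a a' b b' c c' d d' :
    M a b a' b' * M c d c' d' - M a c a' c' * M b d b' d'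
      + M a d a' d' * M b c b' c' = 0 by rewrite /M; ring.
have := plucker v1 w1 v2 w2 v4 w4 v5 w5.
have := plucker v1 w1 v3 w3 v4 w4 v5 w5.
have := plucker v2 w2 v3 w3 v4 w4 v5 w5.
have := plucker v1 w1 v2 w2 v3 w3 v4 w4.
have := plucker v1 w1 v2 w2 v3 w3 v5 w5.
rewrite {plucker}/M -[v5 * w4 - _]opprB.
(* From here on the ten minors are unknowns tied only by the linear and Plucker equations. *)
move: (v1 * w2 - _) (v1 * w3 - _) (v1 * w4 - _) (v1 * w5 - _).
move: (v2 * w3 - _) (v2 * w4 - _) (v2 * w5 - _).
move: (v3 * w4 - _) (v3 * w5 - _) (v4 * w5 - _).
move=> M34 M35 M45 M23 M24 M25 M12 M13 M14 M15 P1235 P1234 P2345 P1345 P1245.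
move=> M12_0 /subr0_eq/esym e1 e2 e3 /subr0_eq e4 /subr0_eq e5 /eqP.
rewrite oppr_eq0 => /eqP M45_0.
move: e2 e3 P1235 P1234 P2345 P1345 P1245; rewrite M12_0 M45_0 e1 e4 e5.
rewrite !(mul0r, mulr0, sub0r, addr0, oppr0) => e2 /eqP.
rewrite oppr_eq0 => /eqP ->.
rewrite !(mul0r, mulr0, sub0r, addr0, add0r, oppr0).
have [t0|nz_t] := eqVneq M35 0.
  move: e2; rewrite t0 !(mul0r, mulr0, addr0) => /subr0_eq ->.
  move=> /eqP; rewrite !mulf_eq0 (negPf nz_g) orbb /= => /eqP ->.
  by rewrite !mulr0 => /eqP; rewrite oppr_eq0 mulf_eq0 orbb => /eqP ->.
move=> _ P1234 /eqP; rewrite oppr_eq0 mulf_eq0 (negPf nz_t) orbF => /eqP M24_0.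
move=> P1345 _; move: P1234; rewrite M24_0 mulr0 oppr0 add0r.
have -> : M15 = M35.
  by apply: (mulIf nz_t); apply/subr0_eq; rewrite -P1345; ring.
by move/eqP; rewrite !mulf_eq0 (negPf nz_g) (negPf nz_t).
Qed.

(** * The code generated by G *)

Section Code.
Variables (F : finFieldType) (L : fieldExtType F) (a : L) (gamma : F).
Hypothesis a_prim : is_primitive_elt a.
Hypothesis m_gt7 : (7 < \dim {:L})%N.

Local Notation G := (alpha_gamma_mx a gamma).

Lemma alpha_gamma_row (x : 'rV[L]_2) j
    (u := x ord0 ord0) (v := x ord0 ord_max) :
  (x *m G) ord0 j =
    nth 0 [:: u; v; u * a + v * a ^+ 2; u * a ^+ 2 + v * a ^+ 4;
              u * a ^+ 3 + v * (gamma *: a)] j.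
Proof.
rewrite mxE big_ord_recr big_ord1 !mxE /=.
have -> : widen_ord (leqnSn 1) ord0 = ord0 by apply: val_inj.
rewrite -/u -/v.
by case: j => -[|[|[|[|[|]]]]] //= _; rewrite ?(mulr0, mulr1, addr0, add0r).
Qed.

Local Notation C := <<[tuple row i G | i < 2]>>%VS.

(** The first two columns of G form the identity, so a combination of rows displays its
    coefficients. *)
Lemma alpha_gamma_basis : is_generator_matrix G C.
Proof.
rewrite /is_generator_matrix basisEfree subvv dim_span !andbT.
apply/freeP => k sum0.
have kG0 : (\row_i k i) *m G = 0.
  rewrite mulmx_sum_row -[RHS]sum0; apply: eq_bigr => i _.
  by rewrite mxE -tnth_nth tnth_mktuple.
move=> i; have := alpha_gamma_row (\row_i k i) (widen_ord (isT : 2 <= 5)%N i).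
rewrite kG0 !mxE.
case: (fintype.unliftP ord_max i) => [j|] ->; rewrite ?ord1 /= => ->;
  by congr k; exact: val_inj.
Qed.

Lemma dim_alpha_gamma : \dim C = 2%N.
Proof. by rewrite (size_basis alpha_gamma_basis). Qed.

(** A relation v on the codeword x G is a linear equation on x, with the two entries of G v^T as
    coefficients. *)
Lemma in_relations_alpha_gamma (x : 'rV[L]_2) (v : 'rV[F]_5) :
  let f := in_alg L in let v_ i := f (v ord0 (inord i)) in
  v \in relations (x *m G) ->
  x ord0 ord0 * (v_ 0%N + v_ 2%N * a + v_ 3%N * a ^+ 2 + v_ 4%N * a ^+ 3)
  + x ord0 ord_max *
      (v_ 1%N + v_ 2%N * a ^+ 2 + v_ 3%N * a ^+ 4 + f gamma * v_ 4%N * a) = 0.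
Proof.
move=> f v_; rewrite mem_relations => /eqP <-; rewrite /relation_map.
have E i : v ord0 i *: (x *m G) ord0 i = v_ i * (x *m G) ord0 i.
  by rewrite /v_ /f inord_val /= mulr_algl.
rewrite (eq_bigr _ (fun i _ => E i)).
rewrite (eq_bigr _ (fun i _ => congr1 _ (alpha_gamma_row x i))).
rewrite !big_ord_recr big_ord0 /= -(mulr_algl gamma) -in_algE -/f; ring.
Qed.

Lemma primitive_elt_horner_rec_eq0 (s : seq F) : (size s <= \dim {:L})%N ->
  foldr (fun c y => y * a + in_alg L c) 0 s = 0 -> forall i, s`_i = 0.
Proof.
have -> : foldr (fun c y => y * a + in_alg L c) 0 s =
    (map_poly (in_alg L) (Poly s)).[a].
  elim: s => [|c s /= ->]; first by rewrite /= rmorph0 horner0.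
  by rewrite cons_poly_def rmorphD rmorphM /= map_polyC map_polyX hornerMXaddC.
move=> sz_s s0 i; rewrite -coef_Poly.
rewrite (poly_primitive_elt_eq0 a_prim _ s0) ?coef0 //.
exact: leq_trans (size_Poly _) sz_s.
Qed.

Lemma dim_relations_alpha_gamma (x : 'rV[L]_2) :
  gamma != 0 -> x != 0 -> (\dim (relations (x *m G)) <= 1)%N.
Proof.
move=> nz_g nz_x; apply: dimv_le1_minors => v w.
move=> /in_relations_alpha_gamma + /in_relations_alpha_gamma.
set f := in_alg L; set X := x _ _; set Y := x _ _.
pose v_ i : F := v ord0 (inord i); pose w_ i : F := w ord0 (inord i).
rewrite -!/(v_ _) -!/(w_ _).
set Pv := (X in _ * X + _ = 0 -> _); set Qv := (X in _ + _ * X = 0 -> _).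
set Pw := (X in _ -> _ * X + _ = 0 -> _).
set Qw := (X in _ -> _ + _ * X = 0 -> _).
move=> Ev Ew.
(* Cramer's rule: the determinant kills both entries of the nonzero [x]. *)
have D0 : Pv * Qw - Pw * Qv = 0.
  have XD : X * (Pv * Qw - Pw * Qv) = 0.
    transitivity (Qw * (X * Pv + Y * Qv) - Qv * (X * Pw + Y * Qw)).
      by ring.
    by rewrite Ev Ew; ring.
  have YD : Y * (Pv * Qw - Pw * Qv) = 0.
    transitivity (Pv * (X * Pw + Y * Qw) - Pw * (X * Pv + Y * Qv)).
      by ring.
    by rewrite Ev Ew; ring.
  apply/eqP; apply: contraNT nz_x => nzD; apply/eqP/rowP => i; rewrite mxE.
  move/eqP: XD; move/eqP: YD; rewrite !mulf_eq0 (negPf nzD) !orbF.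
  move=> /eqP Y0 /eqP X0.
  case: (fintype.unliftP ord_max i) => [j|] -> //.
  by rewrite ord1 -[RHS]X0; congr (x _ _); apply: val_inj.
pose M i j : F := v_ i * w_ j - v_ j * w_ i.
pose s := [:: M 0%N 1%N; gamma * M 0%N 4%N - M 1%N 2%N;
   M 0%N 2%N - M 1%N 3%N + gamma * M 2%N 4%N; gamma * M 3%N 4%N - M 1%N 4%N;
   M 0%N 3%N - M 2%N 3%N; M 2%N 3%N - M 2%N 4%N; 0; M 4%N 3%N].
have sE : foldr (fun c y => y * a + f c) 0 s = 0.
  by rewrite -[RHS]D0; apply/esym; exact: (alpha_gamma_det (in_alg L)).
(* Eight coefficients, for degree at most 7: this is [m_gt7]. *)
have sz_s : (size s <= \dim {:L})%N by [].
have {sE} s0 := primitive_elt_horner_rec_eq0 sz_s sE.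
have [M13 M14 M15 M23 [M24 M25 M34 M35]] := minors_alpha_gamma_eq0 nz_g
  (s0 0%N) (s0 1%N) (s0 2%N) (s0 3%N) (s0 4%N) (s0 5%N) (s0 7%N).
have M45 : M 3%N 4%N = 0 by rewrite /M -opprB [X in - X](s0 7%N) oppr0.
have M12 := s0 0%N.
move=> i j; rewrite -[i]inord_val -[j]inord_val.
rewrite -/(v_ i) -/(v_ j) -/(w_ i) -/(w_ j).
suff M0 k l : (k < l)%N -> (l < 5)%N -> M k l = 0.
  have [lt_ij|lt_ji|->//] := ltngtP i j.
    by apply/subr0_eq; rewrite -[RHS](M0 i j) // /M (mulrC (w_ _)).
  by apply/esym/subr0_eq; rewrite -[RHS](M0 j i) // /M (mulrC (w_ _)).
by move: k l => [|[|[|[|[|k]]]]] [|[|[|[|[|l]]]]].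
Qed.

(** The target distance is 5 - 2 + 1 = 4. At most one independent relation among five coordinates
    gives rank at least 4, and the first row of G attains it because one of its entries is 0. *)
Lemma alpha_gamma_MRD : gamma != 0 -> is_MRD C.
Proof.
move=> nz_g; split; first by rewrite -dimv_eq0 dim_alpha_gamma.
rewrite dim_alpha_gamma.
have dge c : c \in C -> c != 0 -> (4 <= rank_weight c)%N.
  case/(mem_generator_matrix _ alpha_gamma_basis) => x -> nz_xG.
  have nz_x : x != 0 by apply: contraNneq nz_xG => ->; rewrite mul0mx.
  rewrite -(leq_add2l 1); apply: leq_trans (leq_dim_relations_rank _) _.
  exact: leq_add (dim_relations_alpha_gamma nz_g nz_x) (leqnn _).
split=> //; exists (row ord0 G).
have rC : row ord0 G \in C.
  by rewrite -(tnth_mktuple (fun i => row i G)) memv_span ?mem_tnth.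
have nz_r : row ord0 G != 0.
  by apply/eqP => /rowP/(_ ord0); rewrite !mxE /= => /eqP; rewrite oner_eq0.
split=> //; apply/eqP; rewrite eqn_leq dge // andbT.
pose t := [:: 1; a; a ^+ 2; a ^+ 3].
apply: leq_trans (dim_span t); apply/dimvS/span_subvP => _ /tnthP[i ->].
rewrite tnth_mktuple !mxE /=.
by case: i => -[|[|[|[|[|]]]]] //= _;
  rewrite ?mem0v // memv_span // !inE eqxx ?orbT.
Qed.

Lemma alpha_gamma_not_gabidulin :
    (forall s : nat, (0 < s)%N -> (s < \dim {:L})%N -> coprime s (\dim {:L}) ->
       gamma%:A != (a ^+ (#|F| ^ s) + a) *
         (a ^+ (2 * #|F| ^ s) + a ^+ (#|F| ^ s + 1) + a ^+ 2)) ->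
  forall k, ~ is_generalized_gabidulin k C.
Proof.
move=> gamma_neq k [s [g [co_sm free_g gab]]].
have k2 : k = 2%N by rewrite -(size_basis gab) dim_alpha_gamma.
subst k.
have rowC (i : 'I_2) : exists x : 'rV[L]_2, forall j,
    tnth g j ^+ (#|F| ^ (s * i)) = (x *m G) ord0 j.
  have : row i (gabidulin_mx 2 s g) \in C.
    apply/(mem_generator_matrix _ gab); exists (delta_mx ord0 i).
    by rewrite -rowE.
  case/(mem_generator_matrix _ alpha_gamma_basis) => x xG.
  by exists x => j; rewrite -xG !mxE.
have [x Ex] := rowC ord0; have [y Ey] := rowC ord_max.
have {Ex} Ex j : tnth g j = (x *m G) ord0 j by rewrite -Ex muln0 expn0 expr1.
pose i0 : 'I_5 := @Ordinal 5 0 isT; pose i1 : 'I_5 := @Ordinal 5 1 isT.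
pose i2 : 'I_5 := @Ordinal 5 2 isT; pose i4 : 'I_5 := @Ordinal 5 4 isT.
have {Ey} Ey j : (x *m G) ord0 j ^+ (#|F| ^ s) = (y *m G) ord0 j.
  by rewrite -Ey muln1 -Ex.
(* This entry is the second coordinate of [g], nonzero since [g] is free. *)
have Y_neq0 : x ord0 ord_max != 0.
  apply: contraTneq free_g => x1; apply/negP => /freeP free_g.
  have g1 : g`_i1 = 0 by rewrite -tnth_nth Ex alpha_gamma_row.
  have := free_g (fun i => (i == i1)%:R); rewrite (bigD1 i1) // g1 scaler0.
  rewrite big1 => [|i /negPf ->]; last by rewrite scale0r.
  by rewrite /= addr0 => /(_ erefl i1)/eqP; rewrite eqxx oner_eq0.
have := Ey i4; have := Ey i2; have := Ey i1; have := Ey i0.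
rewrite !alpha_gamma_row /= => <- <-.
rewrite !frobD -mulr_algl !exprMn frob_scalar.
have : x ord0 ord_max ^+ (#|F| ^ s) != 0 by rewrite expf_neq0.
have m_gt1 : (1 < \dim {:L})%N by exact: leq_trans m_gt7.
(* As m > 1, an [s] coprime to m is not a multiple of m. *)
have s_gt0 : (0 < s %% \dim {:L})%N.
  rewrite lt0n; apply: contraTneq co_sm => s0; rewrite -coprime_modl s0.
  by rewrite /coprime gcd0n gtn_eqF.
have s_lt : (s %% \dim {:L} < \dim {:L})%N by rewrite ltn_mod ltnW.
have := gamma_neq _ s_gt0 s_lt; rewrite coprime_modl => /(_ co_sm).
have := primitive_elt_frob_neq a_prim s_gt0 s_lt.
rewrite (mulnC 2%N) exprM exprD expr1 -(frob_modn s a).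
move: (x _ _ ^+ _) (x _ _ ^+ _) (a ^+ (_ ^ _)) => U V b.
rewrite -subr_eq0 => b_neq gamma_b V_neq0 E2 E4.
(* [U], [V], [b] are the twists of the entries of [x] and of [a]. The third coordinate reads U b + V
   b^2 = U a + V a^2; divide by b - a. *)
have UE : U = - (V * (b + a)).
  apply/eqP; rewrite -addr_eq0; apply/eqP/(mulIf b_neq).
  by rewrite mul0r -[RHS](subrr (U * a + V * a ^+ 2)) -{1}E2; ring.
(* The fifth reads U b^3 + V gamma b = U a^3 + V gamma a; inserting [UE] and dividing by V (b - a)
   gives gamma = (b + a)(b^2 + b a + a^2). *)
move/negP: gamma_b; apply; apply/eqP/(mulIf b_neq)/(mulfI V_neq0)/subr0_eq.
rewrite -(subrr (U * a ^+ 3 + V * (gamma%:A * a))) -{1}E4 UE; ring.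
Qed.

End Code.

Theorem theorem5p9 (q m : nat) (F : finFieldType) (L : fieldExtType F)
  (hq : #|F| = q) (hL : \dim {:L} = m) (hm : (7 < m)%N)
  (alpha : L) (halpha : is_primitive_elt alpha)
  (gamma : F) (hgamma0 : gamma != 0)
  (hgamma : forall s : nat, (0 < s)%N -> (s < m)%N -> coprime s m ->
     gamma%:A != (alpha ^+ (q ^ s) + alpha) *
       (alpha ^+ (2 * q ^ s) + alpha ^+ (q ^ s + 1) + alpha ^+ 2)) :
  exists C : {vspace 'rV[L]_5},
    [/\ is_generator_matrix (alpha_gamma_mx alpha gamma) C,
        \dim C = 2%N,
        is_MRD C &
        forall k : nat, ~ is_generalized_gabidulin k C].
Proof.
subst q m; exists <<[tuple row i (alpha_gamma_mx alpha gamma) | i < 2]>>%VS.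
split; [exact: alpha_gamma_basis | exact: dim_alpha_gamma
  | exact: alpha_gamma_MRD | exact: alpha_gamma_not_gabidulin].
Qed.
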